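(* Let $\mathcal U$ be a cover of a vertex set $X$, let $T$ be a strictly totally ordered set with initial (least) object $0$, let $\mathcal X^T(\mathcal U)$ be a simplicial cover complex over $\mathcal U$, and let $\alpha:T\to T$ be non-decreasing with $t\le\alpha(t)$. If $\mathcal X^T(V)$ is $\alpha$-acyclic for every $V\in\overline{\mathcal U}$, then for every $k\ge0$, $H_k(\mathcal N(\mathcal U))$ and $H_k(\mathcal X^T(\mathcal U))$ are $(\alpha^{k+1},\mathrm{id})$-interleaved, where $H_k(\mathcal N(\mathcal U))$ is regarded as a constant persistence vector space over $T$.
   Context: A system of complexes over a cover $\mathcal U$ of a set $X$ is a collection of filtered complexes $\{\mathcal X^T(U)\}_{U\in\mathcal U}$ (here simplicial), $\mathcal X^s(U)\subseteq\mathcal X^t(U)$ for $s\le t$ in $T$, where $\mathcal X^T(U)$ has $U$ as its 0-skeleton (at every parameter $t\in T$), and which are compatible on intersections: $\mathcal X^T(U_i)|_{\cap U_k}=\mathcal X^T(U_j)|_{\cap U_k}$ for all $U_i,U_j\in\{U_k\}\subseteq\mathcal U$, where $|_A$ denotes the subcomplex of simplices with all vertices in $A$. The cover complex is $\mathcal X^T(\mathcal U)=\bigcup_{U\in\mathcal U}\mathcal X^T(U)$. $\overline{\mathcal U}$ is the set of all nonempty intersections $V=\bigcap_{i\in I}U_i$ of nonempty families in $\mathcal U$, and $\mathcal X^T(V)=\mathcal X^T(U_i)|_V$ for any $U_i\supseteq V$ in $\mathcal{U}$. $\mathcal N(\mathcal U)$ is the nerve: simplices are finite nonempty subsets of $\mathcal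 U$ with nonempty common intersection. A filtered complex is $\alpha$-acyclic if for every $t\in T$ every (reduced) cycle of its chain complex at parameter $t$ is a boundary at parameter $\alpha(t)$ (in degree 0, cycles are chains of augmentation zero). $\alpha^{k+1}$ is the $(k+1)$-fold composite. Homology has coefficients in a field. Persistence vector spaces $V,W$ over $T$ are $(\alpha,\beta)$-interleaved if there are families of linear maps $F^s:V^s\to W^{\alpha(s)}$ and $G^t:W^t\to V^{\beta(t)}$ commuting with the structure maps, such that $G^{\alpha(s)}\circ F^s$ and $F^{\beta(t)}\circ G^t$ are the structure maps $V^s\to V^{\beta\alpha(s)}$ and $W^t\to W^{\alpha\beta(t)}$. *)

(* Defs.v *)
From HB Require Import structures.
From mathcomp Require Import all_boot all_order all_algebra.
From mathcomp Require Import ring_quotient finmap boolp classical_sets wochoice.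
From mathcomp Require Import monalg.

Set Implicit Arguments.
Unset Strict Implicit.
Unset Printing Implicit Defensive.

Import Order.TTheory GRing.Theory.

Local Open Scope classical_set_scope.
Local Open Scope quotient_scope.
Local Open Scope ring_scope.

(* The library's [Quotient.quot] only carries a Z-module structure. *)
Section QuotientModule.
Variables (K : nzRingType) (M : lmodType K) (N : submodClosed M).

Definition submod_pred : {pred M} := N.
HB.instance Definition _ := GRing.isZmodClosed.Build M submod_pred
  (GRing.submod_closedB (submodClosedP N)).

Definition quotmod : Type := Quotient.quot submod_pred.
HB.instance Definition _ := GRing.Zmodule.on quotmod.
HB.instance Definition _ := EqQuotient.on quotmod.

Definition qproj (x : M) : quotmod := \pi_(Quotient.quot submod_pred) x.

Lemma qproj_eq (x y : M) : qproj x = qproj y <-> x - y \in N.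
Proof.
rewrite -[x - y \in N]/(x - y \in submod_pred) Quotient.idealrBE.
by split=> /eqP.
Qed.

Lemma qproj_repr (u : quotmod) : qproj (repr (u : Quotient.quot submod_pred)) = u.
Proof. exact: reprK. Qed.

Lemma qproj_zmod : zmod_morphism qproj.
Proof. exact: pi_is_zmod_morphism. Qed.
HB.instance Definition _ := GRing.isZmodMorphism.Build M quotmod qproj qproj_zmod.

Definition qscale (a : K) (u : quotmod) : quotmod :=
  qproj (a *: repr (u : Quotient.quot submod_pred)).

Lemma qscaleE a x : qscale a (qproj x) = qproj (a *: x).
Proof.
by apply/qproj_eq; rewrite -scalerBr rpredZ //; apply/qproj_eq/qproj_repr.
Qed.

Lemma qscaleA a b u : qscale a (qscale b u) = qscale (a * b) u.
Proof. by rewrite -[u]qproj_repr !qscaleE scalerA. Qed.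

Lemma qscale1 : left_id 1 qscale.
Proof. by move=> u; rewrite -[u]qproj_repr qscaleE scale1r. Qed.

Lemma qscaleDr : right_distributive qscale +%R.
Proof.
move=> a u v; rewrite -[u]qproj_repr -[v]qproj_repr -raddfD !qscaleE.
by rewrite -raddfD scalerDr.
Qed.

Lemma qscaleDl u : {morph qscale^~ u : a b / a + b}.
Proof.
by move=> a b; rewrite /= -[u]qproj_repr !qscaleE -raddfD scalerDl.
Qed.

HB.instance Definition _ :=
  GRing.Zmodule_isLmodule.Build K quotmod qscaleA qscale1 qscaleDr qscaleDl.

Lemma qproj_scalable : scalable qproj.
Proof. by move=> a x; rewrite -qscaleE. Qed.
HB.instance Definition _ := GRing.isScalable.Build K M quotmod *:%R qproj qproj_scalable.

End QuotientModule.

Section Complexes.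
Variable V : choiceType.

Record scomplex := SComplex {
  simplices :> set {fset V};
  simplex_neq0 : forall s, simplices s -> s != fset0;
  simplex_face : forall s t, simplices s -> (t `<=` s)%fset -> t != fset0 ->
    simplices t }.

Lemma restrict_neq0 (X : scomplex) (A : set V) (s : {fset V}) :
  simplices X s /\ [set` s] `<=` A -> s != fset0.
Proof. by case=> /simplex_neq0. Qed.

Lemma restrict_face (X : scomplex) (A : set V) (s t : {fset V}) :
    simplices X s /\ [set` s] `<=` A -> (t `<=` s)%fset -> t != fset0 ->
  simplices X t /\ [set` t] `<=` A.
Proof.
move=> [Xs sA] ts t0; split; first exact: simplex_face Xs ts t0.
by move=> v vt; apply: sA; apply: (fsubsetP ts).
Qed.

Definition restrict (X : scomplex) (A : set V) : scomplex :=
  SComplex (@restrict_neq0 X A) (@restrict_face X A).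

(* An arbitrary total order on the vertices, used only to orient simplices. *)
Definition vle : rel V := sval (well_ordering_principle V).

(* [vsign s v] is (-1)^i, where i is the position of v in the increasing
   enumeration of s. *)
Definition vsign (K : fieldType) (s : {fset V}) (v : V) : K :=
  (-1) ^+ #|` [fset w in s | (w != v) && vle w v]%fset|.

Definition chains (K : fieldType) : Type := {malg K[{fset V}]}.
HB.instance Definition _ (K : fieldType) := GRing.Lmodule.on (chains K).

Variable K : fieldType.
Implicit Types (c b : chains K) (X Y : scomplex) (k : nat).

(* On a vertex this gives the empty simplex, which spans no chain group below:
   [cycle] and [reduced_cycle] use [bd] in positive degrees only. *)
Definition bd_simplex (s : {fset V}) : chains K :=
  \sum_(v <- s) << vsign K s v *g (s `\ v)%fset >>.

Definition bd c : chains K := \sum_(s <- msupp c) c@_s *: bd_simplex s.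

Definition augmentation c : K := \sum_(s <- msupp c) c@_s.

Lemma msupp_sumw (W : lmodType K) (F : {fset V} -> W) c (D : {fset {fset V}}) :
  (msupp c `<=` D)%fset ->
  \sum_(s <- msupp c) c@_s *: F s = \sum_(s <- D) c@_s *: F s.
Proof.
move=> sD; apply: big_fset_incl => // s _ /mcoeff_outdom ->.
by rewrite scale0r.
Qed.

Lemma msupp_sum_linear (W : lmodType K) (F : {fset V} -> W) :
  linear (fun c : chains K => \sum_(s <- msupp c) c@_s *: F s).
Proof.
move=> a c b /=; set D := (msupp c `|` msupp b `|` msupp (a *: c + b))%fset.
rewrite !(@msupp_sumw W F _ D); first last.
- by apply/fsubsetP => s; rewrite !inE => ->; rewrite ?orbT.
- by apply/fsubsetP => s; rewrite !inE => ->; rewrite ?orbT.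
- by apply/fsubsetP => s; rewrite !inE => ->; rewrite ?orbT.
rewrite scaler_sumr -big_split /=; apply: eq_bigr => s _.
by rewrite mcoeffD mcoeffZ scalerDl scalerA.
Qed.

Lemma bd_linear : linear bd.
Proof. exact: msupp_sum_linear. Qed.
HB.instance Definition _ := GRing.isLinear.Build K (chains K) (chains K) *:%R bd bd_linear.

Lemma vle_order : antisymmetric vle /\ total vle.
Proof.
have wo : wo_chain vle predT.
  by move=> A _; exact: (svalP (well_ordering_principle V)).
split=> [x y|x y]; first exact: (wo_chain_antisymmetric wo).
exact: (wo_chainW wo).
Qed.

Lemma vsign_swap (s : {fset V}) v w : v \in s -> w \in s -> v != w ->
  vsign K s v * vsign K (s `\ v)%fset w = - (vsign K s w * vsign K (s `\ w)%fset v).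
Proof.
have lt_case : forall v w, v \in s -> w \in s -> v != w -> vle v w ->
    vsign K s v * vsign K (s `\ v)%fset w = - (vsign K s w * vsign K (s `\ w)%fset v).
  move=> {}v {}w vs ws vw lvw; rewrite /vsign.
  have wv : ~~ vle w v.
    apply/negP=> lwv; move: vw; rewrite ((proj1 vle_order) v w) ?eqxx //.
    by rewrite lvw.
  have -> : [fset u in (s `\ w) | (u != v) && vle u v]%fset
          = [fset u in s | (u != v) && vle u v]%fset.
    apply/fsetP=> u; rewrite !inE /=.
    by have [->|] := eqVneq u w; rewrite ?(negPf wv) ?andbF.
  have -> : [fset u in (s `\ v) | (u != w) && vle u w]%fset
          = ([fset u in s | (u != w) && vle u w] `\ v)%fset.
    by apply/fsetP=> u; rewrite !inE /= !andbA.
  rewrite [in RHS](cardfsD1 v [fset u in s | (u != w) && vle u w]%fset).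
  by rewrite !inE /= vs vw lvw exprS mulN1r mulNr opprK mulrC.
move=> vs ws vw; have /orP[lvw|lwv] := (proj2 vle_order) v w; first exact: lt_case.
by rewrite [in RHS]lt_case ?opprK // eq_sym.
Qed.

Lemma bd_monalg a s : bd << a *g s >> = a *: bd_simplex s.
Proof.
rewrite /bd (@msupp_sumw _ _ _ [fset s]%fset) ?msuppU_le //.
by rewrite big_seq_fset1 mcoeffUU.
Qed.

Lemma bd_bd c : bd (bd c) = 0.
Proof.
rewrite [bd c]/bd raddf_sum big1 // => s _ /=.
rewrite linearZ /=.
have -> : (bd : {linear _ -> _}) (bd_simplex s) =
    \sum_(v <- s) bd << vsign K s v *g (s `\ v)%fset >>.
  exact: raddf_sum.
suff -> : \sum_(v <- s) bd << vsign K s v *g (s `\ v)%fset >> = 0 by rewrite scaler0.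
pose f v w : chains K :=
  << vsign K s v * vsign K (s `\ v)%fset w *g (s `\ v `\ w)%fset >>.
have fN v w : v \in s -> w \in s -> v != w -> f v w = - f w v.
  move=> vs ws vw; rewrite /f -monalgUN -vsign_swap // fsetDDl fsetUC -fsetDDl.
  by rewrite vsign_swap // opprK -vsign_swap // eq_sym.
pose lt v w := (v != w) && vle v w.
have E v : v \in s -> bd << vsign K s v *g (s `\ v)%fset >> =
   \sum_(w <- s | lt v w) f v w + \sum_(w <- s | lt w v) f v w.
  move=> vs; rewrite bd_monalg scaler_sumr.
  have -> : \sum_(w <- (s `\ v)%fset) vsign K s v *:
      << vsign K (s `\ v)%fset w *g (s `\ v `\ w)%fset >> =
      \sum_(w <- (s `\ v)%fset) f v w.
    by apply: eq_bigr => w _; apply/malgP => u; rewrite mcoeffZ !mcoeffU mulrnAr.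
  have -> : (s `\ v)%fset = [fset w in s | w != v]%fset.
    by apply/fsetP=> w; rewrite !inE andbC.
  rewrite -big_fset_condE (bigID (lt v)) /=; congr (_ + _); apply: eq_bigl => w.
    by rewrite /lt eq_sym; case: eqP.
  rewrite /lt [v == w]eq_sym; have [//|wv /=] := eqVneq w v.
  have [anti tot] := vle_order; have := tot v w; have := anti v w.
  by case: (vle v w) (vle w v) => -[] //= /(_ isT) vw; rewrite vw eqxx in wv.
rewrite big_seq (eq_bigr _ E) -big_seq big_split /= [X in _ + X]big_seq.
rewrite [X in _ + X](eq_bigr (fun v => \sum_(w <- s) if lt w v then f v w else 0)).
  rewrite -big_seq [X in _ + X]exchange_big -big_split /= big_seq big1 // => v vs.
  rewrite -big_mkcond -big_split /= big_seq_cond big1 // => w /and3P[ws vw _].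
  by rewrite fN // addNr.
by move=> v _; rewrite big_mkcond.
Qed.

Definition chain k X c := forall s, s \in msupp c -> simplices X s /\ #|` s| = k.+1.

Definition cycle k X c := chain k X c /\ ((0 < k)%N -> bd c = 0).

Definition reduced_cycle k X c :=
  chain k X c /\ (if k is 0 then augmentation c = 0 else bd c = 0).

Definition boundary k X c := exists2 b, chain k.+1 X b & c = bd b.

Lemma chain_closed k X a c b : chain k X c -> chain k X b -> chain k X (a *: c + b).
Proof.
move=> hc hb s; rewrite -mcoeff_neq0 mcoeffD mcoeffZ => h.
have [sc|sc] := boolP (s \in msupp c); first exact: hc.
by apply: hb; move: h; rewrite (mcoeff_outdom sc) mulr0 add0r mcoeff_neq0.
Qed.

Lemma chain0 k X : chain k X 0.
Proof. by move=> s; rewrite msupp0 in_fset0. Qed.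

Lemma boundary_cycle k X c : boundary k X c -> cycle k X c.
Proof.
move=> [b hb ->]; split=> [t|_]; last exact: bd_bd.
rewrite -mcoeff_neq0 /bd raddf_sum /= => h.
have [s sb hs] : exists2 s, s \in msupp b & (b@_s *: bd_simplex s)@_t != 0.
  apply: contrapT => no; move/eqP: h; apply; rewrite big_seq big1 // => s sb.
  by apply/eqP/negPn/negP => hs; apply: no; exists s.
have [v vs tE] : exists2 v, v \in s & t = (s `\ v)%fset.
  apply: contrapT => no; move/eqP: hs; apply; rewrite mcoeffZ raddf_sum /=.
  rewrite big_seq big1 ?mulr0 // => v vs.
  rewrite mcoeffU; case: eqP => // e; case: no; by exists v.
have [Xs s_card] := hb s sb.
have t_card : #|` t| = k.+1 by move: s_card; rewrite (cardfsD1 v) vs -tE => -[].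
split=> //; apply: (simplex_face Xs); first by rewrite tE fsubD1set.
by rewrite -cardfs_gt0 t_card.
Qed.

Definition cycle_pred k X : {pred chains K} := [pred c | `[< cycle k X c >]].

Lemma cycle_predP k X c : reflect (cycle k X c) (c \in cycle_pred k X).
Proof. exact: asboolP. Qed.

Lemma cycle_submod k X : submod_closed (cycle_pred k X).
Proof.
split=> [|a c b].
  by apply/cycle_predP; split=> [|_]; [exact: chain0 | rewrite raddf0].
move=> /cycle_predP[hc dc] /cycle_predP[hb db]; apply/cycle_predP; split.
  exact: chain_closed.
by move=> k0; rewrite bd_linear dc ?db // scaler0 addr0.
Qed.
HB.instance Definition _ k X :=
  GRing.isSubmodClosed.Build K (chains K) (cycle_pred k X) (cycle_submod k X).

Record cycles k X : predArgType := Cycle {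
  cycle_val :> chains K;
  cycleP : cycle_val \in cycle_pred k X }.
HB.instance Definition _ k X := [isSub for @cycle_val k X].
HB.instance Definition _ k X := [Choice of cycles k X by <:].
HB.instance Definition _ k X := [SubChoice_isSubLmodule of cycles k X by <:].

Definition boundary_pred k X : {pred cycles k X} :=
  [pred z | `[< boundary k X (val z) >]].

Lemma boundary_predP k X (z : cycles k X) :
  reflect (boundary k X (val z)) (z \in @boundary_pred k X).
Proof. exact: asboolP. Qed.

Lemma boundary_submod k X : submod_closed (@boundary_pred k X).
Proof.
split=> [|a y z].
  by apply/boundary_predP; exists 0; [exact: chain0 | rewrite !raddf0].
move=> /boundary_predP[c hc ec] /boundary_predP[b hb eb]; apply/boundary_predP.
exists (a *: c + b); first exact: chain_closed.
by rewrite linearP bd_linear -ec -eb.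
Qed.
HB.instance Definition _ k X :=
  GRing.isSubmodClosed.Build K (cycles k X) (@boundary_pred k X) (@boundary_submod k X).

Definition homology k X : lmodType K := quotmod (@boundary_pred k X).

Section Inclusion.
Variables (k : nat) (X Y : scomplex) (XY : X `<=` Y).

Lemma chain_incl n c : chain n X c -> chain n Y c.
Proof. by move=> h s /h[/XY]. Qed.

Lemma cycle_incl c : c \in cycle_pred k X -> c \in cycle_pred k Y.
Proof.
by move=> /cycle_predP[hc dc]; apply/cycle_predP; split=> //; exact: chain_incl.
Qed.

Definition cycles_incl (z : cycles k X) : cycles k Y := Cycle (cycle_incl (cycleP z)).

Lemma cycles_incl_linear : linear cycles_incl.
Proof. by move=> a y z; apply: val_inj. Qed.
HB.instance Definition _ := GRing.isLinear.Build K (cycles k X) (cycles k Y) *:%R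
  cycles_incl cycles_incl_linear.

Definition homology_incl_fun (u : homology k X) : homology k Y :=
  qproj (@boundary_pred k Y)
    (cycles_incl (repr (u : Quotient.quot (submod_pred (@boundary_pred k X))))).

Lemma homology_incl_funE (z : cycles k X) :
  homology_incl_fun (qproj (@boundary_pred k X) z) =
  qproj (@boundary_pred k Y) (cycles_incl z).
Proof.
apply/qproj_eq; rewrite -raddfB.
have /qproj_eq := qproj_repr (qproj (@boundary_pred k X) z).
move=> /boundary_predP[b hb eb]; apply/boundary_predP; exists b => //.
exact: chain_incl.
Qed.

Lemma homology_incl_linear : linear homology_incl_fun.
Proof.
move=> a u v; rewrite -[u]qproj_repr -[v]qproj_repr -linearP !homology_incl_funE.
by rewrite !linearP.
Qed.
HB.instance Definition _ := GRing.isLinear.Build K (homology k X) (homology k Y) *:%R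
  homology_incl_fun homology_incl_linear.

Definition homology_incl : {linear homology k X -> homology k Y} := homology_incl_fun.

Lemma homology_inclE (z : cycles k X) :
  homology_incl (qproj (@boundary_pred k X) z) =
  qproj (@boundary_pred k Y) (cycles_incl z).
Proof. exact: homology_incl_funE. Qed.

End Inclusion.

Lemma homology_incl_id k X (h : X `<=` X) (u : homology k X) : homology_incl k h u = u.
Proof.
rewrite -[u]qproj_repr [LHS]homology_inclE; congr (qproj _ _).
exact: val_inj.
Qed.

Lemma homology_incl_comp k X Y (Z : scomplex) (hXY : X `<=` Y) (hYZ : Y `<=` Z)
    (hXZ : X `<=` Z) (u : homology k X) :
  homology_incl k hYZ (homology_incl k hXY u) = homology_incl k hXZ u.
Proof.
rewrite -[u]qproj_repr; set z := repr _.
rewrite [X in homology_incl k hYZ X]homology_inclE homology_inclE [RHS]homology_inclE.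
by congr (qproj _ _); apply: val_inj.
Qed.

End Complexes.

Record persvect (K : fieldType) (d : Order.disp_t) (T : porderType d) := PersVect {
  pv_space :> T -> lmodType K;
  pv_map : forall s t, (s <= t)%O -> {linear pv_space s -> pv_space t};
  pv_map_id : forall s (h : (s <= s)%O) x, pv_map h x = x;
  pv_map_comp : forall r s t (h1 : (r <= s)%O) (h2 : (s <= t)%O) (h3 : (r <= t)%O) x,
    pv_map h2 (pv_map h1 x) = pv_map h3 x }.

Definition constant_persvect (K : fieldType) (d : Order.disp_t) (T : porderType d)
    (W : lmodType K) : persvect K T :=
  @PersVect K d T (fun=> W) (fun _ _ _ => idfun : {linear W -> W})
    (fun _ _ _ => erefl) (fun _ _ _ _ _ _ _ => erefl).

(* The first four components only provide the inequalities indexing the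
   structure maps that occur in the interleaving equations. *)
Definition interleaved (K : fieldType) (d : Order.disp_t) (T : porderType d)
    (alpha beta : T -> T) (V W : persvect K T) : Prop :=
  exists (ma : forall s t, (s <= t)%O -> (alpha s <= alpha t)%O)
         (mb : forall s t, (s <= t)%O -> (beta s <= beta t)%O)
         (ba : forall s, (s <= beta (alpha s))%O)
         (ab : forall t, (t <= alpha (beta t))%O)
         (F : forall s, {linear V s -> W (alpha s)})
         (G : forall t, {linear W t -> V (beta t)}),
  [/\ forall s t (h : (s <= t)%O) x, F t (pv_map V h x) = pv_map W (ma s t h) (F s x),
      forall s t (h : (s <= t)%O) y, G t (pv_map W h y) = pv_map V (mb s t h) (G s y),
      forall s x, G (alpha s) (F s x) = pv_map V (ba s) x
    & forall t y, F (beta t) (G t y) = pv_map W (ab t) y].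

Record filtered (d : Order.disp_t) (T : porderType d) (V : choiceType) := Filtered {
  level :> T -> scomplex V;
  level_le : forall s t, (s <= t)%O -> level s `<=` level t }.

Section Filtered.
Variables (d : Order.disp_t) (T : porderType d) (V : choiceType).
Implicit Types (X : filtered T V).

Lemma frestrict_le X (A : set V) (s t : T) :
  (s <= t)%O -> restrict (X s) A `<=` restrict (X t) A.
Proof. by move=> st x [/(level_le st)]. Qed.

Definition frestrict X (A : set V) : filtered T V :=
  Filtered (@frestrict_le X A).

Definition homology_persvect (K : fieldType) (k : nat) X : persvect K T :=
  @PersVect K d T (fun t => homology K k (X t))
    (fun s t h => homology_incl K k (@level_le _ _ _ X s t h))
    (fun s h => homology_incl_id (@level_le _ _ _ X s s h))
    (fun r s t h1 h2 h3 =>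
       homology_incl_comp (@level_le _ _ _ X r s h1) (@level_le _ _ _ X s t h2)
         (@level_le _ _ _ X r t h3)).

Definition acyclic (K : fieldType) (alpha : T -> T) X : Prop :=
  forall (t : T) (n : nat) (c : chains V K),
    reduced_cycle n (X t) c -> boundary n (X (alpha t)) c.

Implicit Type U : set (set V).

(* [Xs A] is only meaningful for [A] in [U]. *)
Definition system_of_complexes U (Xs : set V -> filtered T V) : Prop :=
  (forall A, U A -> forall t v, simplices (Xs A t) [fset v]%fset <-> A v) /\
  (forall F A B, F `<=` U -> F A -> F B ->
     let I := \bigcap_(C in F) C in
     forall t, simplices (frestrict (Xs A) I t) = simplices (frestrict (Xs B) I t)).

Lemma cover_complex_neq0 U (Xs : set V -> filtered T V) t s :
  (\bigcup_(A in U) Xs A t) s -> s != fset0.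
Proof. by case=> A _ /simplex_neq0. Qed.

Lemma cover_complex_face U (Xs : set V -> filtered T V) t s s' :
  (\bigcup_(A in U) Xs A t) s -> (s' `<=` s)%fset -> s' != fset0 ->
  (\bigcup_(A in U) Xs A t) s'.
Proof. by move=> [A UA Xs_s] ss s0; exists A => //; exact: simplex_face ss s0. Qed.

Lemma cover_complex_le U (Xs : set V -> filtered T V) s t : (s <= t)%O ->
  \bigcup_(A in U) Xs A s `<=` \bigcup_(A in U) Xs A t.
Proof. by move=> st x [A UA /(level_le st) h]; exists A. Qed.

Definition cover_complex U (Xs : set V -> filtered T V) : filtered T V :=
  @Filtered d T V
    (fun t => SComplex (@cover_complex_neq0 U Xs t) (@cover_complex_face U Xs t))
    (@cover_complex_le U Xs).

End Filtered.

Section Nerve.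
Variables (V : choiceType) (U : set (set V)).

Definition nonempty_intersections : set (set V) :=
  [set B | B !=set0 /\
    exists F : set (set V), [/\ F `<=` U, F !=set0 & B = \bigcap_(A in F) A]].

Definition nerve_simplices : set {fset set V} :=
  [set s | [/\ s != fset0, [set` s] `<=` U & \bigcap_(A in [set` s]) A !=set0]].

Lemma nerve_neq0 s : nerve_simplices s -> s != fset0.
Proof. by case. Qed.

Lemma nerve_face s t :
  nerve_simplices s -> (t `<=` s)%fset -> t != fset0 -> nerve_simplices t.
Proof.
move=> [_ sU [x sx]] /fsubsetP ts t0; split=> //.
  by move=> A /ts; exact: sU.
by exists x => A /ts; exact: sx.
Qed.

Definition nerve : scomplex (set V) := SComplex nerve_neq0 nerve_face.

End Nerve.

(* Main.v *)
Require Import Defs.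
From HB Require Import structures.
From mathcomp Require Import all_boot all_order all_algebra.
From mathcomp Require Import finmap boolp classical_sets monalg.

(* Consider the bicomplex spanned by the pairs (s, t) of a simplex s of the cover
   complex and a simplex t of the nerve such that s lies in every member of t.
   Fixing s, the t's form a full simplex, so total cycles at parameter [a] have
   the same homology as the cover complex at [a].  Fixing t, the s's form the
   alpha-acyclic complex of the intersection of t; hence a cycle of the nerve lifts
   to a total cycle whose component of bidegree (p, q) lives at parameter
   alpha^p(a), and this total cycle bounds if the given cycle does.  So "being the
   two ends of a common total cycle" is a linear relation between the homologies of
   the nerve and of the cover complex.  Restricted to constant parameters it is the
   graph of the maps G, restricted to the parameters alpha^p(a) it is the graph of
   the maps F; since both are restrictions of one relation, the interleaving
   identities hold. *)

Set Implicit Arguments.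
Unset Strict Implicit.
Unset Printing Implicit Defensive.

Import Order.TTheory GRing.Theory.

Local Open Scope classical_set_scope.
Local Open Scope ring_scope.

(** * Linear extension from a basis, and chains with prescribed support *)

Section LinearExtension.
Variables (K : fieldType) (G : choiceType).

Section Extension.
Variables (M : lmodType K) (F : G -> M).

Definition lin (c : {malg K[G]}) : M := \sum_(s <- msupp c) c@_s *: F s.

Lemma linw (c : {malg K[G]}) (D : {fset G}) :
  (msupp c `<=` D)%fset -> lin c = \sum_(s <- D) c@_s *: F s.
Proof.
move=> cD; apply: big_fset_incl => // s _ /mcoeff_outdom ->.
by rewrite scale0r.
Qed.

Lemma lin_linear : linear lin.
Proof.
move=> a c b; set D := (msupp c `|` msupp b `|` msupp (a *: c + b))%fset.
rewrite !(@linw _ D); try by apply/fsubsetP => s; rewrite !inE => ->; rewrite ?orbT.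
rewrite scaler_sumr -big_split /=; apply: eq_bigr => s _.
by rewrite mcoeffD mcoeffZ scalerDl scalerA.
Qed.
HB.instance Definition _ :=
  GRing.isLinear.Build K {malg K[G]} M *:%R lin lin_linear.

Lemma linU a s : lin << a *g s >> = a *: F s.
Proof. by rewrite (linw msuppU_le) big_seq_fset1 mcoeffUU. Qed.

Lemma linB s : lin << s >> = F s.
Proof. by rewrite linU scale1r. Qed.

End Extension.

Lemma monalgUZ a (s : G) : << a *g s >> = a *: << s >> :> {malg K[G]}.
Proof. by apply/malgP => r; rewrite mcoeffZ !mcoeffU mulrnAr mulr1. Qed.

Lemma scaleU a b (s : G) : a *: << b *g s >> = << a * b *g s >> :> {malg K[G]}.
Proof. by apply/malgP => r; rewrite mcoeffZ !mcoeffU mulrnAr. Qed.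

Lemma linear_eq (M : lmodType K) (f g : {linear {malg K[G]} -> M}) c :
  (forall s, s \in msupp c -> f << s >> = g << s >>) -> f c = g c.
Proof.
move=> fg; rewrite [c]monalgE !raddf_sum big_seq [RHS]big_seq.
by apply: eq_bigr => s sc; rewrite monalgUZ /= !linearZ /= fg.
Qed.

Definition supported (P : G -> Prop) (c : {malg K[G]}) :=
  forall s, s \in msupp c -> P s.

Lemma msupp_eq0Vmem (c : {malg K[G]}) : c = 0 \/ exists s, s \in msupp c.
Proof.
have [c0|[s sc]] := fset_0Vmem (msupp c); last by right; exists s.
by left; rewrite [c]monalgE c0 big_seq_fset0.
Qed.

Lemma supported0 P : supported P 0.
Proof. by move=> s; rewrite msupp0. Qed.

Lemma supportedP P a c b :
  supported P c -> supported P b -> supported P (a *: c + b).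
Proof.
move=> Pc Pb s; rewrite -mcoeff_neq0 mcoeffD mcoeffZ => h.
have [sc|sc] := boolP (s \in msupp c); first exact: Pc.
by apply: Pb; move: h; rewrite (mcoeff_outdom sc) mulr0 add0r mcoeff_neq0.
Qed.

Lemma supportedZ P a c : supported P c -> supported P (a *: c).
Proof.
by move=> Pc; rewrite -[_ *: _]addr0; apply: supportedP => //; exact: supported0.
Qed.

Lemma supportedB P c b : supported P c -> supported P b -> supported P (c - b).
Proof. by move=> Pc Pb; rewrite addrC -scaleN1r; exact: supportedP. Qed.

Lemma supported_sum P (I : eqType) (r : seq I) (f : I -> {malg K[G]}) :
  (forall i, i \in r -> supported P (f i)) -> supported P (\sum_(i <- r) f i).
Proof.
move=> Pf; rewrite big_seq; elim/big_ind: _ => // [|c b Pc Pb].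
  exact: supported0.
by rewrite -[c]scale1r; exact: supportedP.
Qed.

Lemma supportedU (P : G -> Prop) a s : P s -> supported P << a *g s >>.
Proof. by move=> Ps r /(fsubsetP msuppU_le); rewrite inE => /eqP ->. Qed.

Lemma supported_imp (P Q : G -> Prop) c :
  (forall s, P s -> Q s) -> supported P c -> supported Q c.
Proof. by move=> PQ Pc s /Pc /PQ. Qed.

End LinearExtension.

Lemma supported_lin (K : fieldType) (G H : choiceType)
    (F : G -> {malg K[H]}) (P : G -> Prop) (Q : H -> Prop) c :
  supported P c -> (forall s, P s -> supported Q (F s)) -> supported Q (lin F c).
Proof.
move=> Pc PQ; apply: supported_sum => s sc.
by apply: supportedZ; apply: PQ; exact: Pc.
Qed.

(** * The cone operator on augmented simplicial chains *)

Section Boundary.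
Variables (K : fieldType) (V : choiceType).
Implicit Types (s : {fset V}) (v w : V).

Lemma bdB s : bd (<< s >> : chains V K) = bd_simplex K s.
Proof. by rewrite bd_monalg scale1r. Qed.

Lemma vsign_sq s v : vsign K s v * vsign K s v = 1.
Proof. by rewrite /vsign -expr2 sqrr_sign. Qed.

(** The only vertex of a 0-simplex has sign 1 and its deletion leaves the empty simplex. Hence [bd]
    encodes the augmentation in degree 0, which matches the condition in [reduced_cycle]. *)
Lemma bd_vertices (c : chains V K) :
  supported (fun s => #|` s| = 1)%N c -> bd c = augmentation c *: << fset0 >>.
Proof.
move=> c1; rewrite /bd /augmentation scaler_suml big_seq [RHS]big_seq.
apply: eq_bigr => s /c1 /eqP /cardfs1P[v ->]; congr (_ *: _).
rewrite /bd_simplex big_seq_fset1 fsetDv /vsign.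
suff -> : [fset w in [fset v] | (w != v) && vle w v]%fset = fset0.
  by rewrite cardfs0.
by apply/fsetP => w; rewrite !inE; case: eqP.
Qed.

(** The join with [v], signed so that the face opposite [v] has coefficient 1 in the boundary. *)
Definition cone v : chains V K -> chains V K :=
  lin (fun s => if v \in s then 0 else << vsign K (v |` s)%fset v *g (v |` s)%fset >>).
HB.instance Definition _ v := GRing.Linear.on (cone v).

Lemma coneE v a s : cone v << a *g s >> =
  a *: (if v \in s then 0 else << vsign K (v |` s)%fset v *g (v |` s)%fset >>).
Proof. exact: linU. Qed.

Lemma supported_cone (P Q : {fset V} -> Prop) v (c : chains V K) :
    supported P c -> (forall s, v \notin s -> P s -> Q (v |` s)%fset) ->
  supported Q (cone v c).
Proof.
move=> Pc PQ; apply: (supported_lin Pc) => s Ps.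
case: ifPn => vs; first exact: supported0.
apply: supportedU; exact: PQ.
Qed.

(** A contracting homotopy: a chain killed by [bd] is the boundary of its cone. If [v] lies in [s],
    only the face opposite [v] survives coning; otherwise the faces of the join that contain [v]
    cancel the cones over the faces of [s]. *)
Lemma bd_cone v (c : chains V K) : bd (cone v c) + cone v (bd c) = c.
Proof.
pose f : {linear chains V K -> chains V K} :=
  (@bd V K \o cone v) \+ (cone v \o @bd V K).
apply: (@linear_eq K _ _ f idfun) => s _; rewrite /f /= bdB coneE scale1r.
rewrite [cone v _]raddf_sum /=; case: ifPn => vs.
  rewrite raddf0 add0r (big_fsetD1 v) //= coneE !inE eqxx /= fsetD1K //.
  rewrite scaleU vsign_sq big_seq big1 ?addr0 // => w.
  rewrite !inE => /andP[wv ws].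
  by rewrite coneE !inE vs eq_sym wv /= scaler0.
rewrite bd_monalg /bd_simplex big_fsetU1 //= scalerDr scaler_sumr fsetU1K //.
rewrite scaleU vsign_sq -addrA -big_split /=.
rewrite big_seq big1 ?addr0 // => w ws.
have wv : w != v by apply: contraNneq vs => <-.
rewrite coneE !inE (negPf vs) andbF.
have -> : (v |` (s `\ w) = (v |` s) `\ w)%fset.
  apply/fsetP => u; rewrite !inE; case: (eqVneq u v) => [->|] //=.
  by rewrite eq_sym wv.
rewrite !scaleU -monalgUD.
have := @vsign_swap V K (v |` s)%fset v w; rewrite fsetU1K // !inE eqxx ws orbT eq_sym.
move=> /(_ isT isT wv).
set a := vsign K (v |` s)%fset v; set b := vsign K s w.
set e := vsign K (v |` s)%fset w; set f' := vsign K _ v => abef.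
(* [abef] reads [a * b = - (e * f')]; multiplying by [b * e] gives the cancellation, since signs
   square to 1. *)
have -> : a * e = - (b * f'); last by rewrite addNr monalgU0.
have -> : a * e = (a * b) * (b * e) by rewrite mulrA -(mulrA a) vsign_sq mulr1.
by rewrite abef mulNr [e * f']mulrC -mulrA [e * _]mulrC -mulrA vsign_sq mulr1 mulrC.
Qed.
End Boundary.

(** * Bichains: the tensor product of two chain modules and its two differentials *)

Section Bichains.
Variables (K : fieldType) (V W : choiceType).

Definition bichains : Type := {malg K[({fset V} * {fset W})%type]}.
HB.instance Definition _ := GRing.Lmodule.on bichains.

Definition tens (x : chains V K) (y : chains W K) : bichains :=
  lin (fun s => lin (fun t => << (s, t) >> : bichains) y) x.

Lemma tensl_linear y : linear (tens^~ y).
Proof. exact: lin_linear. Qed.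

Lemma tensr_linear x : linear (tens x).
Proof.
move=> a y y'; rewrite -![tens x _]/(\sum_(s <- msupp x) _) scaler_sumr -big_split /=.
by apply: eq_bigr => s _; rewrite lin_linear scalerDr !scalerA mulrC.
Qed.
HB.instance Definition _ x :=
  GRing.isLinear.Build K (chains W K) bichains *:%R (tens x) (tensr_linear x).

Definition tensl y x := tens x y.
HB.instance Definition _ y :=
  GRing.isLinear.Build K (chains V K) bichains *:%R (tensl y) (tensl_linear y).

Lemma tensB s t : tens << s >> << t >> = << (s, t) >>.
Proof. by rewrite /tens !linB. Qed.

Lemma supported_tens (P : {fset V} -> Prop) (Q : {fset W} -> Prop)
    (R : {fset V} * {fset W} -> Prop) x y :
    supported P x -> supported Q y -> (forall s t, P s -> Q t -> R (s, t)) ->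
  supported R (tens x y).
Proof.
move=> Px Qy PQ; apply: (supported_lin Px) => s Ps.
apply: (supported_lin Qy) => t Qt; apply: supportedU; exact: PQ.
Qed.

Lemma tens_ext (M : lmodType K) (f g : {linear bichains -> M}) :
  (forall s t, f (tens << s >> << t >>) = g (tens << s >> << t >>)) -> f =1 g.
Proof.
move=> fg c; apply: (@linear_eq K _ M f g) => -[s t] _.
by have := fg s t; rewrite tensB.
Qed.

(** Neither differential carries a sign depending on the other factor, so [d1] and [d2] commute
    instead of anticommuting. *)
Definition d1 : bichains -> bichains :=
  lin (fun p => tens (bd_simplex K p.1) << p.2 >>).
HB.instance Definition _ := GRing.Linear.on d1.

Definition d2 : bichains -> bichains :=
  lin (fun p => tens << p.1 >> (bd_simplex K p.2)).
HB.instance Definition _ := GRing.Linear.on d2.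

Lemma d1_tens x y : d1 (tens x y) = tens (bd x) y.
Proof.
apply: (@linear_eq K _ _ (d1 \o tens x) (tens (bd x))) => t _ /=.
apply: (@linear_eq K _ _ (d1 \o tensl << t >>) (tensl << t >> \o @bd V K)) => s _ /=.
by rewrite /tensl tensB /d1 linB bdB.
Qed.

Lemma d2_tens x y : d2 (tens x y) = tens x (bd y).
Proof.
apply: (@linear_eq K _ _ (d2 \o tens x) (tens x \o @bd W K)) => t _ /=.
apply: (@linear_eq K _ _ (d2 \o tensl << t >>) (tensl (bd << t >>))) => s _ /=.
by rewrite /tensl tensB /d2 linB bdB.
Qed.

Lemma d1_d2 c : d1 (d2 c) = d2 (d1 c).
Proof.
apply: (@tens_ext _ (d1 \o d2) (d2 \o d1)) => s t /=.
rewrite [d2 (tens _ _)]d2_tens [LHS]d1_tens.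
by rewrite [d1 (tens _ _)]d1_tens [RHS]d2_tens.
Qed.

Lemma d1_d1 c : d1 (d1 c) = 0.
Proof.
apply: (@tens_ext _ (d1 \o d1) \0) => s t /=.
by rewrite [d1 (tens _ _)]d1_tens [LHS]d1_tens bd_bd [LHS](raddf0 (tensl _)).
Qed.

Lemma d2_d2 c : d2 (d2 c) = 0.
Proof.
apply: (@tens_ext _ (d2 \o d2) \0) => s t /=.
by rewrite [d2 (tens _ _)]d2_tens [LHS]d2_tens bd_bd raddf0.
Qed.

Lemma supported_d1 (P Q : {fset V} * {fset W} -> Prop) c :
    supported P c -> (forall s t v, P (s, t) -> v \in s -> Q ((s `\ v)%fset, t)) ->
  supported Q (d1 c).
Proof.
move=> Pc PQ; apply: (supported_lin Pc) => -[s t] /= Pst.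
apply: (@supported_tens (fun s' => exists2 v, v \in s & s' = (s `\ v)%fset) (eq t)).
- apply: supported_sum => v vs; apply: supportedU; by exists v.
- exact: supportedU.
- by move=> _ _ [v vs ->] <-; exact: PQ.
Qed.

Lemma supported_d2 (P Q : {fset V} * {fset W} -> Prop) c :
    supported P c -> (forall s t w, P (s, t) -> w \in t -> Q (s, (t `\ w)%fset)) ->
  supported Q (d2 c).
Proof.
move=> Pc PQ; apply: (supported_lin Pc) => -[s t] /= Pst.
apply: (@supported_tens (eq s) (fun t' => exists2 w, w \in t & t' = (t `\ w)%fset)).
- exact: supportedU.
- apply: supported_sum => v vs; apply: supportedU; by exists v.
- by move=> _ _ <- [v vs ->]; exact: PQ.
Qed.

Definition slice (t : {fset W}) : bichains -> chains V K :=
  lin (fun p => if p.2 == t then << p.1 >> else 0).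
HB.instance Definition _ t := GRing.Linear.on (slice t).

Lemma slice_tens t x t' : slice t (tens x << t' >>) = if t' == t then x else 0.
Proof.
(* The case distinction is packed into a linear map, so that the identity can be checked on
   generators. *)
pose f : {linear chains V K -> chains V K} :=
  if t' == t then (idfun : {linear _ -> _}) else (\0 : {linear _ -> _}).
rewrite [RHS](_ : _ = f x); last by rewrite /f; case: ifP.
apply: (@linear_eq K _ _ (slice t \o tensl << t' >>) f) => s _ /=.
by rewrite /tensl tensB /slice linB /f /=; case: ifP.
Qed.

Lemma supported_slice (P : {fset V} * {fset W} -> Prop) t c :
  supported P c -> supported (fun s => P (s, t)) (slice t c).
Proof.
move=> Pc; apply: (supported_lin Pc) => -[s t'] /= Pst.
case: eqP => [<-|_]; [exact: supportedU|exact: supported0].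
Qed.

Lemma slice_d1 t c : slice t (d1 c) = bd (slice t c).
Proof.
apply: (@tens_ext _ (slice t \o d1) (@bd V K \o slice t)) => s t' /=.
rewrite [d1 (tens _ _)]d1_tens [LHS]slice_tens [slice t (tens << s >> _)]slice_tens.
by case: ifP => // _; rewrite raddf0.
Qed.

Lemma slice_sum (D : {fset {fset W}}) c : supported (fun p => p.2 \in D) c ->
  c = \sum_(t <- D) tens (slice t c) << t >>.
Proof.
move=> cD; pose h t : {linear bichains -> bichains} := tensl << t >> \o slice t.
have E t : tens (slice t c) << t >> = \sum_(p <- msupp c) h t << c@_p *g p >>.
  by rewrite -[RHS]raddf_sum -monalgE.
rewrite [LHS]monalgE big_seq (eq_bigr _ (fun t _ => E t)) [RHS]exchange_big big_seq.
apply: eq_bigr => -[s t] /cD /= tD.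
have hB t' : h t' << c@_(s, t) *g (s, t) >> =
    if t == t' then << c@_(s, t) *g (s, t) >> else 0.
  rewrite monalgUZ linearZ /h /= -tensB [slice _ _]slice_tens /tensl.
  by case: ifP => [/eqP -> //|_]; rewrite [tens 0 _](raddf0 (tensl _)) scaler0.
rewrite [RHS](eq_bigr _ (fun t' _ => hB t')) (big_fsetD1 t) //= eqxx.
rewrite big_seq big1 ?addr0 // => t'.
by rewrite !inE eq_sym => /andP[/negPf -> _].
Qed.

(** [d1] leaves the second simplex alone: each slice of [c] is a cycle in its own fibre and is
    filled there, and the finitely many fillings are added up. *)
Lemma fiberwise_exact (P Q : {fset V} * {fset W} -> Prop) c :
    supported P c -> d1 c = 0 ->
    (forall t x, supported (fun s => P (s, t)) x -> bd x = 0 ->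
       exists2 y : chains V K, supported (fun s => Q (s, t)) y & bd y = x) ->
  exists2 b, supported Q b & d1 b = c.
Proof.
move=> Pc dc exact_fiber.
have /choice[f fP] t : exists y : chains V K,
    supported (fun s => Q (s, t)) y /\ bd y = slice t c.
  have [||y] := exact_fiber t (slice t c); last by exists y.
    exact: supported_slice.
  by rewrite -slice_d1 dc raddf0.
pose D := [fset p.2 | p in msupp c]%fset.
exists (\sum_(t <- D) tens (f t) << t >>).
  apply: supported_sum => t _; have [Qf _] := fP t.
  apply: (supported_tens Qf (Q := eq t)); first exact: supportedU.
  by move=> s _ + <-.
rewrite raddf_sum [RHS](@slice_sum D) => [|p pc]; last exact: in_imfset.
by apply: eq_bigr => t _; rewrite [LHS]d1_tens (fP t).2.
Qed.

End Bichains.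

(** * Exchange of the two factors, carrying row statements over to columns *)

Section Transposition.
Variable K : fieldType.

Definition swap (V W : choiceType) : bichains K V W -> bichains K W V :=
  lin (fun p => tens << p.2 >> << p.1 >>).
HB.instance Definition _ V W := GRing.Linear.on (@swap V W).

Variables V W : choiceType.
Implicit Type c : bichains K V W.

Lemma swap_tensB (s : {fset V}) (t : {fset W}) :
  swap (tens << s >> << t >> : bichains K V W) = tens << t >> << s >>.
Proof. by rewrite tensB /swap linB. Qed.

Lemma swap_tens (x : chains V K) (y : chains W K) : swap (tens x y) = tens y x.
Proof.
apply: (@linear_eq K _ _ (@swap V W \o tens x) (tensl x)) => t _ /=.
apply: (@linear_eq K _ _ (@swap V W \o tensl << t >>) (tens << t >>)) => s _ /=.
exact: swap_tensB.
Qed.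

Lemma supported_swap (P : {fset V} * {fset W} -> Prop) c :
  supported P c -> supported (fun p => P (p.2, p.1)) (swap c).
Proof.
move=> Pc; apply: (supported_lin Pc) => -[s t] Pst; rewrite tensB.
exact: supportedU.
Qed.

Lemma swap_d1 c : swap (d1 c) = d2 (swap c).
Proof.
apply: (@tens_ext _ _ _ _ (@swap V W \o @d1 K V W) (@d2 K W V \o @swap V W)) => s t /=.
by rewrite [d1 _]d1_tens [LHS]swap_tens [swap _]swap_tens [RHS]d2_tens.
Qed.

Lemma swap_d2 c : swap (d2 c) = d1 (swap c).
Proof.
apply: (@tens_ext _ _ _ _ (@swap V W \o @d2 K V W) (@d1 K W V \o @swap V W)) => s t /=.
by rewrite [d2 _]d2_tens [LHS]swap_tens [swap _]swap_tens [RHS]d1_tens.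
Qed.

Lemma tens_inj2 (t : {fset W}) (x x' : chains V K) :
  tens x << t >> = tens x' << t >> -> x = x'.
Proof. by move=> /(congr1 (slice t)); rewrite [LHS]slice_tens [RHS]slice_tens eqxx. Qed.

End Transposition.

Section Columns.
Variables (K : fieldType) (V W : choiceType).
Implicit Type c : bichains K V W.

Lemma swapK c : swap (swap c) = c.
Proof.
apply: (@tens_ext _ _ _ _ (@swap K W V \o @swap K V W) idfun) => s t /=.
by rewrite !swap_tensB.
Qed.

Lemma fiberwise_exact2 (P Q : {fset V} * {fset W} -> Prop) c :
    supported P c -> d2 c = 0 ->
    (forall s y, supported (fun t => P (s, t)) y -> bd y = 0 ->
       exists2 z : chains W K, supported (fun t => Q (s, t)) z & bd z = y) ->
  exists2 b, supported Q b & d2 b = c.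
Proof.
move=> Pc dc exact_fiber.
have [|b Qb db] :=
    fiberwise_exact (supported_swap Pc) _ (Q := fun p => Q (p.2, p.1)) exact_fiber.
  by rewrite -swap_d2 dc raddf0.
exists (swap b); first by apply: supported_imp (supported_swap Qb) => -[].
by rewrite -swap_d1 db swapK.
Qed.

Lemma tens_inj1 (s : {fset V}) (y y' : chains W K) :
  tens << s >> y = tens << s >> y' -> y = y'.
Proof.
move=> /(congr1 (@swap K V W)); rewrite [LHS]swap_tens [RHS]swap_tens.
exact: tens_inj2.
Qed.

Lemma supported_snd (P : {fset V} * {fset W} -> Prop) t c :
    supported P c -> (forall p, P p -> p.2 = t) ->
  exists2 x, supported (fun s => P (s, t)) x & c = tens x << t >>.
Proof.
move=> Pc Pt; exists (slice t c); first exact: supported_slice.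
rewrite {1}(@slice_sum _ _ _ [fset t]%fset c) ?big_seq_fset1 //.
by apply: supported_imp Pc => p /Pt ->; rewrite inE.
Qed.

Lemma supported_fst (P : {fset V} * {fset W} -> Prop) s c :
    supported P c -> (forall p, P p -> p.1 = s) ->
  exists2 y, supported (fun t => P (s, t)) y & c = tens << s >> y.
Proof.
move=> Pc Ps; exists (slice s (swap c)).
  exact: supported_slice (supported_swap Pc).
rewrite -swap_tens -[LHS]swapK; congr (swap _).
rewrite {1}(@slice_sum _ _ _ [fset s]%fset (swap c)) ?big_seq_fset1 //.
by apply: supported_imp (supported_swap Pc) => -[t s'] /Ps /= ->; rewrite inE.
Qed.

End Columns.

(** * Staircases in an abstract bicomplex *)

Section Zigzags.
Variable E : zmodType.

(* A chain of the total complex of a bicomplex with commuting differentials;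
   [S p q] holds the chains of bidegree [(p, q)], and the total cycle condition
   reads [d (m i.+1) = d' (m i)], without signs. *)
Definition zigzag (d d' : E -> E) (S : nat -> nat -> E -> Prop) k (m : nat -> E)
    (z x : E) : Prop :=
  [/\ forall i, (i <= k)%N -> S i.+1 (k - i).+1 (m i),
      d (m 0%N) = z,
      forall i, (i < k)%N -> d (m i.+1) = d' (m i)
    & d' (m k) = x].

(** Reading a staircase from its other end exchanges the differentials, so the results below serve
    both directions. *)
Lemma zigzag_transpose d d' S k m z x :
    zigzag d d' S k m z x ->
  zigzag d' d (fun p q => S q p) k (fun i => m (k - i)%N) x z.
Proof.
move=> [Sm dm0 dm dmk]; split; rewrite ?subn0 ?subnn //.
  by move=> i ik; have := Sm _ (leq_subr i k); rewrite subKn.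
move=> i ik; rewrite -(subnSK ik) dm //.
by rewrite subnSK // leq_subr.
Qed.

Variables d d' : {additive E -> E}.
Hypothesis dd' : forall c, d (d' c) = d' (d c).
Hypothesis d'd' : forall c, d' (d' c) = 0.

Lemma zigzag_cycle S k m z x :
  zigzag d d' S k m z x -> (0 < k)%N -> d x = 0.
Proof.
case: k => // k [_ _ dm <-] _.
by rewrite dd' dm ?d'd' // ltnSn.
Qed.

(** Exactness is asked at [q.+1], because [q = 0] holds the targets of the augmentation [d'].
    Filling raises [p], the index that may carry a growing parameter. *)
Record exact_rows (S : nat -> nat -> E -> Prop) : Prop := ExactRows {
  rows_sub : forall p q c b, S p q c -> S p q b -> S p q (c - b);
  rows_d' : forall p q c, S p q.+1 c -> S p q (d' c);
  rows_exact : forall p q c, S p q.+1 c -> d c = 0 ->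
    exists2 b, S p.+1 q.+1 b & d b = c }.

Lemma exact_rows_shift S : exact_rows S -> exact_rows (fun p => S p.+1).
Proof. by case=> sub dS ex; split=> [p|p|p]; [exact: sub|exact: dS|exact: ex]. Qed.

(** Lift [z] through [d] to [m0]. Then [d (d' m0) = d' z = 0], so [d' m0] can be lifted in turn, and
    the induction continues from it with the column [p = 0] dropped. *)
Lemma zigzag_exists S k z : exact_rows S ->
    S 0%N k.+1 z -> d z = 0 -> ((0 < k)%N -> d' z = 0) ->
  exists m, zigzag d d' S k m z (d' (m k)).
Proof.
elim: k S z => [|k IH] S z ES Sz dz d'z; have [m0 Sm0 dm0] := rows_exact ES Sz dz.
  by exists (fun=> m0); split=> // -[].
have [||_|m [Sm dm0' dm _]] := IH _ (d' m0) (exact_rows_shift ES).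
- exact: (rows_d' ES).
- by rewrite dd' dm0 d'z.
- exact: d'd'.
exists (fun i => if i is j.+1 then m j else m0).
by split=> // -[|i] ik //; [exact: Sm|exact: dm].
Qed.

(** With [d b0 = w], the corrected component [m 0 - d' b0] is killed by [d]. For [k = 0] it lifts to
    some [b1], and [d' b1] fills [x]; otherwise it takes over the role of [w] one column further. *)
Lemma zigzag_boundary S k m z x w : exact_rows S ->
    zigzag d d' S k m z x -> S 0%N k.+2 w -> d w = 0 -> d' w = z ->
  exists2 y, S k.+2 0%N y & d y = x.
Proof.
elim: k S m z w => [|k IH] S m z w ES [Sm dm0 dm dmx] Sw dw d'w;
  have [b0 Sb0 db0] := rows_exact ES Sw dw;
  have [|b1 Sb1 db1] := rows_exact ES (rows_sub ES (Sm 0%N isT) (rows_d' ES Sb0)).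
- by rewrite raddfB dm0 dd' db0 d'w subrr.
- exists (d' b1); first exact: (rows_d' ES).
  by rewrite dd' db1 raddfB d'd' subr0.
- by rewrite raddfB dm0 dd' db0 d'w subrr.
(* Without [m 0] the zigzag starts at [d' (m 0)], which equals [d' (m 0 - d' b0)]. *)
apply: (IH _ (fun i => m i.+1) _ _ (exact_rows_shift ES) _
  (rows_sub ES (Sm 0%N isT) (rows_d' ES Sb0))).
- by split=> [i ik|//|i ik|//]; [have := Sm i.+1 ik; rewrite subSS|exact: dm].
- by rewrite raddfB dm0 dd' db0 d'w subrr.
- by rewrite raddfB d'd' subr0 dm.
Qed.

End Zigzags.

(** * From linear relations to linear maps *)

Lemma linear_of_relation (K : fieldType) (V W : lmodType K) (R : V -> W -> Prop) :
    (forall v, exists w, R v w) -> (forall w, R 0 w -> w = 0) ->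
    (forall a v w v' w', R v w -> R v' w' -> R (a *: v + v') (a *: w + w')) ->
  exists f : {linear V -> W}, forall v w, R v w <-> w = f v.
Proof.
move=> /choice[f Rf] R0 RP.
(* Two values at the same [v] differ by a value at 0, which vanishes. *)
have fE v w : R v w <-> w = f v.
  split=> [Rvw|->//]; have := RP (-1) _ _ _ _ (Rf v) Rvw.
  by rewrite !scaleN1r addNr addrC => /R0 /eqP; rewrite subr_eq0 => /eqP.
have f_linear : linear f by move=> a v w; apply/esym/fE/RP.
pose f' := GRing.isLinear.Build K V W *:%R f f_linear.
by exists (HB.pack_for {linear V -> W} f f').
Qed.

Lemma homology_eq0 (V : choiceType) (K : fieldType) k (Y : scomplex V)
    (z : cycles K k Y) :
  qproj (@boundary_pred V K k Y) z = 0 <-> boundary k Y (val z).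
Proof.
rewrite -[X in _ = X](raddf0 (qproj (@boundary_pred V K k Y))) qproj_eq subr0.
by split=> /boundary_predP.
Qed.

(** * The bicomplex of the cover and the exactness of its rows and columns *)

Section CoverBicomplex.
Variables (K : fieldType) (X : choiceType) (U : set (set X)).
Variables (d : Order.disp_t) (T : porderType d) (Xs : set X -> filtered T X).
Hypothesis Xs_system : system_of_complexes U Xs.
Let C := cover_complex U Xs.

Lemma cover_simplex_sub t A (s : {fset X}) v :
  U A -> simplices (Xs A t) s -> v \in s -> A v.
Proof.
move=> UA As vs; apply/(Xs_system.1 A UA t v); apply: simplex_face As _ _.
  by rewrite fsub1set.
by apply/fset0Pn; exists v; rewrite inE.
Qed.

(** The simplex comes from some [B] in [U] and has its vertices in both [A] and [B]; compatibility
    for the pair of [A] and [B] moves it into the complex of [A]. *)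
Lemma cover_simplex_in t A (s : {fset X}) :
  U A -> simplices (C t) s -> (forall v, v \in s -> A v) -> simplices (Xs A t) s.
Proof.
move=> UA [B UB Bs] sA.
have FU : [set A; B] `<=` U by move=> _ [->|->].
have := Xs_system.2 [set A; B] A B FU (or_introl erefl) (or_intror erefl) t.
move=> /(congr1 (fun Y : set {fset X} => Y s)) /= AB.
suff [] : simplices (Xs A t) s /\ [set` s] `<=` \bigcap_(D in [set A; B]) D by [].
rewrite AB; split=> // v vs _ [->|->]; first exact: sA.
exact: cover_simplex_sub Bs vs.
Qed.

(* The empty simplex is allowed on either side: the columns [p = 0] and the rows
   [q = 0] are the augmentations to the chains of the nerve and of the cover
   complex. *)
Definition bisimplex (l : nat -> T) p q (s : {fset X} * {fset set X}) : Prop :=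
  [/\ #|` s.1| = p, #|` s.2| = q, s.1 != fset0 -> simplices (C (l p)) s.1,
      s.2 != fset0 -> simplices (nerve U) s.2
    & forall A v, A \in s.2 -> v \in s.1 -> A v].

Definition bichain l p q (c : bichains K X (set X)) := supported (bisimplex l p q) c.

Lemma bichain_d2 l p q c : bichain l p q.+1 c -> bichain l p q (d2 c).
Proof.
move=> Sc; apply: (supported_d2 Sc) => s t A [/= sp tq Cs Nt st] At.
split=> //=.
- by move: tq; rewrite (cardfsD1 A) At => -[].
- apply: (@simplex_face _ (nerve U) t); last exact: fsubD1set.
  by apply: Nt; apply/fset0Pn; exists A.
- by move=> B v; rewrite !inE => /andP[_ Bt]; exact: st.
Qed.

(** The parameter is constant here because [d1] lowers [p]: a face of a simplex at [l p.+1] need not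
    be present at [l p]. *)
Lemma bichain_d1 t p q c :
  bichain (fun=> t) p.+1 q c -> bichain (fun=> t) p q (d1 c).
Proof.
move=> Sc; apply: (supported_d1 Sc) => s r v [/= sp rq Cs Nr sr] vs.
split=> //=.
- by move: sp; rewrite (cardfsD1 v) vs => -[].
- apply: (@simplex_face _ (C t) s); last exact: fsubD1set.
  by apply: Cs; apply/fset0Pn; exists v.
- by move=> B w Br; rewrite !inE => /andP[_ ws]; exact: sr.
Qed.

Section Acyclic.
Variable alpha : T -> T.
Hypothesis Xs_acyclic : forall V : set X, nonempty_intersections U V ->
  forall A : set X, U A -> V `<=` A -> acyclic K alpha (frestrict (Xs A) V).

(** Acyclicity is applied to the intersection of each [t]. As [p] counts vertices, a cycle of
    dimension [p] at parameter [l p.+1] is filled at [l p.+2], one [alpha] later. *)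
Lemma bichain_exact1 l p q c : (forall p, l p.+2 = alpha (l p.+1)) ->
    bichain l p q.+1 c -> d1 c = 0 ->
  exists2 b, bichain l p.+1 q.+1 b & d1 b = c.
Proof.
move=> lE Sc dc; apply: (fiberwise_exact Sc dc) => t x Sx dx.
have [->|[s0 s0x]] := msupp_eq0Vmem x.
  by exists 0; [exact: supported0|exact: raddf0].
have [_ /= tq _ Nt _] := Sx s0 s0x.
have t0 : t != fset0 by rewrite -cardfs_gt0 tq.
have {Nt}Nt := Nt t0; have [_ tU [v vt]] := Nt.
have [A At] := fset0Pn _ t0; have UA := tU A At.
(* For [p = 0], [x] is a multiple of the empty simplex and is filled by a vertex common to all
   members of [t]. Vertices are present at every parameter, so this step costs no [alpha]. *)
case: p Sc Sx s0x => [|p] Sc Sx s0x.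
  exists (cone v x); last by have := bd_cone v x; rewrite dx raddf0 addr0.
  apply: (supported_cone Sx) => s vs [/= /eqP]; rewrite cardfs_eq0 => /eqP -> _ _ _ _.
  split=> //=; rewrite fsetU0.
  - exact: cardfs1.
  - by move=> _; exists A => //; apply/(Xs_system.1 A UA); exact: vt.
  - by move=> B w Bt; rewrite inE => /eqP ->; exact: vt.
pose I := \bigcap_(B in [set` t]) B.
have NI : nonempty_intersections U I.
  by split; [exists v|exists [set` t]; split=> //; exists A].
have IA : I `<=` A by move=> w; exact.
have [b Sb xE] : boundary p (frestrict (Xs A) I (alpha (l p.+1))) x.
  apply: (Xs_acyclic NI UA IA); split=> [s /Sx[/= sp _ Cs _ st]|].
    have sn : s != fset0 by rewrite -cardfs_gt0 sp.
    split=> //; split; last by move=> w ws B Bt; exact: st.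
    by apply: cover_simplex_in => [//||w]; [exact: Cs|exact: st].
  (* In dimension 0 the augmentation is the coefficient of the empty simplex in [bd x]. *)
  case: p Sc Sx s0x => [|//] Sc Sx s0x.
  have := @bd_vertices K X x (fun s sx => let: And5 e _ _ _ _ := Sx s sx in e).
  rewrite dx => /(congr1 (fun c : chains X K => c@_fset0)) /=.
  by rewrite mcoeff0 mcoeffZ mcoeffUU mulr1.
exists b => // s /Sb[[/= As sI] sp]; split=> //=.
- by move=> _; rewrite lE; exists A.
- by move=> B w Bt ws; exact: sI.
Qed.

Lemma exact_rows1 l : (forall p, l p.+2 = alpha (l p.+1)) ->
  exact_rows (@d1 K X (set X)) (@d2 K X (set X)) (bichain l).
Proof.
move=> lE; split=> [p q c b|p q c|p q c].
- exact: supportedB.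
- exact: bichain_d2.
- exact: bichain_exact1.
Qed.

End Acyclic.

(** A nonempty [s] is a simplex over some [A] in [U], and [A] serves as apex: adding it to [t] stays
    in the nerve because all members contain the vertices of [s]. The parameter does not change. *)
Lemma bichain_exact2 l p q c : bichain l p.+1 q c -> d2 c = 0 ->
  exists2 b, bichain l p.+1 q.+1 b & d2 b = c.
Proof.
move=> Sc dc; apply: (fiberwise_exact2 Sc dc) => s y Sy dy.
have [->|[t0 t0y]] := msupp_eq0Vmem y.
  by exists 0; [exact: supported0|exact: raddf0].
have [/= sp _ Cs _ _] := Sy t0 t0y.
have s0 : s != fset0 by rewrite -cardfs_gt0 sp.
have [A UA As] := Cs s0; have [v vs] := fset0Pn _ s0.
have sA w : w \in s -> A w by exact: (cover_simplex_sub UA As).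
exists (cone A y); last by have := bd_cone A y; rewrite dy raddf0 addr0.
apply: (supported_cone Sy) => t At [/= _ tq _ Nt st].
have stA B w : B \in (A |` t)%fset -> w \in s -> B w.
  by rewrite !inE => /orP[/eqP ->|Bt]; [exact: sA|exact: st].
split=> //=; first by rewrite cardfsU1 At tq.
move=> tA0; split=> // [B|]; last by exists v => B Bt; exact: stA Bt vs.
rewrite /= !inE => /orP[/eqP -> //|Bt].
have [|_ tU _] := Nt; last exact: tU.
by apply/fset0Pn; exists B.
Qed.

Lemma exact_rows2 t :
  exact_rows (@d2 K X (set X)) (@d1 K X (set X)) (fun p q => bichain (fun=> t) q p).
Proof.
split=> [p q c b|p q c|p q c].
- exact: supportedB.
- exact: bichain_d1.
- exact: bichain_exact2.
Qed.

End CoverBicomplex.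

Lemma linear_comb (K : fieldType) (V W : lmodType K) (f : {linear V -> W}) a
    (x y : V) (x' y' : W) :
  f x = x' -> f y = y' -> f (a *: x + y) = a *: x' + y'.
Proof. by move=> <- <-; exact: linearP. Qed.

(** * The relation between the homologies of the nerve and of the cover complex *)

Section Correspondence.
Variables (K : fieldType) (X : choiceType) (U : set (set X)).
Variables (d : Order.disp_t) (T : porderType d) (Xs : set X -> filtered T X).
Hypothesis Xs_system : system_of_complexes U Xs.
Let C := cover_complex U Xs.
Local Notation D1 := (@d1 K X (set X)).
Local Notation D2 := (@d2 K X (set X)).

(** The parameter [t] of the homology class is kept apart from the parameters [l] of the zigzag, so
    that either can be enlarged separately. *)
Definition corr (l : nat -> T) k t (u : homology K k (nerve U))
    (h : homology K k (C t)) : Prop :=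
  exists (z : cycles K k (nerve U)) (x : cycles K k (C t)) m,
    [/\ u = qproj (@boundary_pred _ K k _) z, h = qproj (@boundary_pred _ K k _) x
      & zigzag D1 D2 (bichain U Xs l) k m (tens << fset0 >> (val z))
          (tens (val x) << fset0 >>)].

Lemma corr_linear l k t a (u u' : homology K k (nerve U)) (h h' : homology K k (C t)) :
  corr l u h -> corr l u' h' -> corr l (a *: u + u') (a *: h + h').
Proof.
move=> [z [x [m [-> -> [Sm dm0 dm dmk]]]]] [z' [x' [m' [-> -> [Sm' dm0' dm' dmk']]]]].
exists (a *: z + z'), (a *: x + x'), (fun i => a *: m i + m' i).
split; [by rewrite linearP|by rewrite linearP|split].
- by move=> i ik; apply: supportedP; [exact: Sm|exact: Sm'].
- exact: etrans (linear_comb a dm0 dm0') (esym (tensr_linear _ a _ _)).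
- move=> i ik; rewrite [RHS]linearP; apply: linear_comb; [exact: dm|exact: dm'].
- exact: etrans (linear_comb a dmk dmk') (esym (tensl_linear _ a _ _)).
Qed.

Lemma corr_le l l' k t (u : homology K k (nerve U)) (h : homology K k (C t)) :
  (forall p, (p <= k.+1)%N -> (l p <= l' p)%O) -> corr l u h -> corr l' u h.
Proof.
move=> ll [z [x [m [-> -> [Sm dm0 dm dmk]]]]]; exists z, x, m; split=> //; split=> //.
move=> i ik; apply: supported_imp (Sm i ik) => s [sp sq Cs Ns ss]; split=> // s0.
exact: (level_le (ll i.+1 ik)) (Cs s0).
Qed.

Lemma corr_incl l k t t' (tt' : (t <= t')%O) (u : homology K k (nerve U))
    (h : homology K k (C t)) :
  corr l u h -> corr l u (homology_incl K k (level_le tt') h).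
Proof.
move=> [z [x [m [-> -> zz]]]]; exists z, (cycles_incl (level_le tt') x), m; split=> //.
exact: homology_inclE.
Qed.

Lemma d1_nerve (z : chains (set X) K) : D1 (tens << fset0 >> z) = 0.
Proof.
rewrite [LHS]d1_tens bdB /bd_simplex big_seq_fset0.
exact: (raddf0 (tensl z)).
Qed.

Lemma d2_cover (x : chains X K) : D2 (tens x << fset0 >>) = 0.
Proof. by rewrite [LHS]d2_tens bdB /bd_simplex big_seq_fset0 raddf0. Qed.

Lemma bichain_nerve l k (z : chains (set X) K) :
  chain k (nerve U) z -> bichain U Xs l 0 k.+1 (tens << fset0 >> z).
Proof.
move=> cz; apply: (supported_tens (P := eq fset0) _ cz); first exact: supportedU.
by move=> _ t <- [Nt tk]; split.
Qed.

Lemma bichain_cover l k (x : chains X K) :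
  chain k (C (l k.+1)) x -> bichain U Xs l k.+1 0 (tens x << fset0 >>).
Proof.
move=> cx; apply: (supported_tens (Q := eq fset0) cx); first exact: supportedU.
by move=> s _ [Cs sk] <-; split.
Qed.

Lemma bichain_nerveP l k (c : bichains K X (set X)) : bichain U Xs l 0 k.+1 c ->
  exists2 z, chain k (nerve U) z & c = tens << fset0 >> z.
Proof.
move=> Sc; have [s [/eqP]|z Sz ->] := supported_fst (s := fset0) Sc.
  by rewrite cardfs_eq0 => /eqP.
exists z => // t /Sz[/= _ tk _ Nt _]; split=> //; apply: Nt.
by rewrite -cardfs_gt0 tk.
Qed.

Lemma bichain_coverP l k (c : bichains K X (set X)) : bichain U Xs l k.+1 0 c ->
  exists2 x, chain k (C (l k.+1)) x & c = tens x << fset0 >>.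
Proof.
move=> Sc; have [s [_ /eqP]|x Sx ->] := supported_snd (t := fset0) Sc.
  by rewrite cardfs_eq0 => /eqP.
exists x => // s /Sx[/= sk _ Cs _ _]; split=> //; apply: Cs.
by rewrite -cardfs_gt0 sk.
Qed.

(** The staircase that starts at a representative of [u] ends in the row [q = 0], at parameter
    [l k.+1], in a cycle of the cover complex. *)
Lemma corr_total1 l k t (u : homology K k (nerve U)) :
    exact_rows D1 D2 (bichain U Xs l) -> (l k.+1 <= t)%O ->
  exists h : homology K k (C t), corr l u h.
Proof.
move=> ex lt; pose z : cycles K k (nerve U) := repr u.
have [cz dz] : Defs.cycle k (nerve U) (val z) by apply/cycle_predP; exact: cycleP.
have [|m zz] := zigzag_exists (@d1_d2 K X (set X)) (@d2_d2 K X (set X)) ex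
    (bichain_nerve l cz) (d1_nerve _).
  by move=> k0; rewrite [LHS]d2_tens dz // raddf0.
have [Sm dm0 dm _] := zz.
have Smk : bichain U Xs l k.+1 0 (D2 (m k)).
  by apply: (rows_d' ex); have := Sm k (leqnn k); rewrite subnn.
have [x cx dmx] := bichain_coverP Smk.
have Zx : x \in cycle_pred k (C t).
  apply/cycle_predP; split=> [s /cx[Cs sk]|k0].
    by split=> //; exact: (level_le lt) Cs.
  apply: (@tens_inj2 K X (set X) fset0); rewrite [RHS](raddf0 (tensl _)) -d1_tens -dmx.
  exact: (zigzag_cycle (@d1_d2 K X (set X)) (@d2_d2 K X (set X)) zz).
exists (qproj _ (Cycle Zx)), z, (Cycle Zx), m; split; [by rewrite qproj_repr|by []|].
by rewrite -dmx.
Qed.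

(** Filling the end of the staircase reaches one column beyond it, hence the bound on [l k.+2]
    instead of [l k.+1]. *)
Lemma corr_fun1 l k t (h : homology K k (C t)) :
    exact_rows D1 D2 (bichain U Xs l) -> (l k.+2 <= t)%O ->
  corr l 0 h -> h = 0.
Proof.
move=> ex lt [z [x [m [z0 -> zz]]]]; apply/homology_eq0.
have /homology_eq0[w cw zw] := esym z0.
have [|y Sy dy] := zigzag_boundary (@d1_d2 K X (set X)) (@d2_d2 K X (set X)) ex zz
    (bichain_nerve l cw) (d1_nerve _).
  by rewrite [LHS]d2_tens -zw.
have [b cb yb] := bichain_coverP Sy.
exists b; first by move=> s /cb[Cs sk]; split=> //; exact: (level_le lt) Cs.
apply: (@tens_inj2 K X (set X) fset0).
exact: etrans (esym dy) (etrans (congr1 _ yb) (d1_tens _ _)).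
Qed.

(** The staircase is built from the cover side with the transposed bicomplex, whose exactness needs
    no change of parameter, and is then read backwards. *)
Lemma corr_total2 t k (h : homology K k (C t)) :
  exists u : homology K k (nerve U), corr (fun=> t) u h.
Proof.
pose x : cycles K k (C t) := repr h.
have [cx dx] : Defs.cycle k (C t) (val x) by apply/cycle_predP; exact: cycleP.
have ex := exact_rows2 K Xs_system t.
have [|m zz] := zigzag_exists (fun c => esym (d1_d2 c)) (@d1_d1 K X (set X)) ex
    (bichain_cover (l := fun=> t) cx) (d2_cover _).
  by move=> k0; rewrite [LHS]d1_tens dx // [LHS](raddf0 (tensl _)).
have [Sm dm0 dm _] := zz.
have Smk : bichain U Xs (fun=> t) 0 k.+1 (D1 (m k)).
  by apply: (rows_d' ex); have := Sm k (leqnn k); rewrite subnn.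
have [z cz dmz] := bichain_nerveP Smk.
have Zz : z \in cycle_pred k (nerve U).
  apply/cycle_predP; split=> // k0.
  apply: (@tens_inj1 K X (set X) fset0); rewrite [RHS]raddf0 -d2_tens -dmz.
  exact: (zigzag_cycle (fun c => esym (d1_d2 c)) (@d1_d1 K X (set X)) zz).
exists (qproj _ (Cycle Zz)), (Cycle Zz), x, (fun i => m (k - i)%N).
split; [by []|by rewrite qproj_repr|].
by rewrite -dmz; exact: zigzag_transpose zz.
Qed.

Lemma corr_fun2 t k (u : homology K k (nerve U)) :
  corr (fun=> t) u (0 : homology K k (C t)) -> u = 0.
Proof.
move=> [z [x [m [-> x0 zz]]]]; apply/homology_eq0.
have /homology_eq0[w cw xw] := esym x0.
have [|y Sy dy] := zigzag_boundary (fun c => esym (d1_d2 c)) (@d1_d1 K X (set X))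
    (exact_rows2 K Xs_system t) (zigzag_transpose zz)
    (bichain_cover (l := fun=> t) cw) (d2_cover _).
  by rewrite [LHS]d1_tens -xw.
have [b cb yb] := bichain_nerveP Sy.
exists b => //; apply: (@tens_inj1 K X (set X) fset0).
exact: etrans (esym dy) (etrans (congr1 _ yb) (d2_tens _ _)).
Qed.

End Correspondence.

(** * The interleaving maps and their identities *)

Theorem theorem3p8 (K : fieldType) (X : choiceType) (U : set (set X))
    (d : Order.disp_t) (T : bOrderType d)
    (Xs : set X -> filtered T X) (alpha : T -> T)
    (U_cover : \bigcup_(A in U) A = setT)
    (Xs_system : system_of_complexes U Xs)
    (alpha_nondecreasing : forall s t : T, (s <= t)%O -> (alpha s <= alpha t)%O)
    (alpha_ge : forall t : T, (t <= alpha t)%O)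
    (Xs_acyclic : forall V : set X, nonempty_intersections U V ->
       forall A : set X, U A -> V `<=` A -> acyclic K alpha (frestrict (Xs A) V))
    (k : nat) :
  interleaved (iter k.+1 alpha) idfun
    (constant_persvect T (homology K k (nerve U)))
    (homology_persvect K k (cover_complex U Xs)).
Proof.
pose C := cover_complex U Xs.
(* The predecessor records that passing from the empty simplex to vertices is free; thus [l s k.+2]
   is exactly the parameter [iter k.+1 alpha s] of the target of [F]. *)
pose l s p := iter p.-1 alpha s.
have iter_homo n s t : (s <= t)%O -> (iter n alpha s <= iter n alpha t)%O.
  by move=> st; elim: n => //= n; exact: alpha_nondecreasing.
have iter_le m n s : (m <= n)%N -> (iter m alpha s <= iter n alpha s)%O.
  move=> /subnK <-; elim: (n - m)%N => // j; rewrite addSn /= => /le_trans; exact.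
have ex s : exact_rows (@d1 K X (set X)) (@d2 K X (set X)) (bichain U Xs (l s)).
  exact: (exact_rows1 Xs_system Xs_acyclic).
have Fex s : exists F : {linear homology K k (nerve U) ->
      homology K k (C (iter k.+1 alpha s))}, forall u h, corr (l s) u h <-> h = F u.
  apply: linear_of_relation => [u|h|a u h u' h'].
  (* A corresponding cycle exists already after [k] applications of [alpha]; the last one is spent
     on the uniqueness of its class. *)
  - by apply: (corr_total1 u (ex s)); exact: iter_le.
  - exact: (corr_fun1 (ex s)).
  - exact: corr_linear.
have Gex t : exists G : {linear homology K k (C t) -> homology K k (nerve U)},
    forall h u, corr (fun=> t) u h <-> u = G h.
  apply: linear_of_relation => [h|u|a h u h' u'].
  - exact: corr_total2.
  - exact: corr_fun2.
  - exact: corr_linear.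
pose F s := sval (cid (Fex s)).
have FP s : forall u h, corr (l s) u h <-> h = F s u.
  exact: svalP (cid (Fex s)).
pose G t := sval (cid (Gex t)).
have GP t : forall h u, corr (fun=> t) u h <-> u = G t h.
  exact: svalP (cid (Gex t)).
exists (iter_homo k.+1), (fun _ _ => id), (fun s => iter_le 0%N k.+1 s isT),
  (fun s => iter_le 0%N k.+1 s isT), F, G; split=> [s t st u|s t st h|s u|t h] /=.
- apply/esym/FP; have /FP := erefl (F s u).
  move=> /(corr_incl (iter_homo k.+1 s t st)); apply: corr_le => p _.
  exact: iter_homo.
- apply/esym/GP; have /GP := erefl (G s h).
  by move=> /(corr_incl st); apply: corr_le.
(* The zigzag defining [F s u] only involves [p <= k.+1], so all of it lives at the constant
   parameter [iter k.+1 alpha s] and also computes [G]. *)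
- apply/esym/GP; have /FP := erefl (F s u).
  apply: corr_le => p pk; apply: (iter_le p.-1 k.+1 s).
  exact: leq_trans (leq_pred p) pk.
(* A zigzag at constant parameter [t] is also one for [l t], since [t] lies below each [l t p];
   pushing its end forward computes [F]. *)
- apply/esym/FP; have /GP := erefl (G t h).
  move=> /(corr_incl (iter_le 0%N k.+1 t isT)); apply: corr_le => p _.
  exact: (iter_le 0%N p.-1 t).
Qed.
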